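(* Let $n\ge 4$. Then $$\mathcal D_{n-4}^{(n)}=\operatorname{disc}(At^4+Bt^2+Ct+D),$$ where $$A=\frac{n!}{24},\quad B=-\frac{(n-2)!}{4}p_2,\quad C=-\frac{(n-3)!}{3}p_3,\quad D=(n-4)!\left(\frac{p_2^2}{8}-\frac{p_4}{4}\right).$$ Equivalently, $$\mathcal D_{n-4}^{(n)}=256A^3D^3-128A^2B^2D^2+144A^2BC^2D-27A^2C^4+16AB^4D-4AB^3C^2.$$ In particular, for real roots $x_1,\dots,x_n$ this gives the sharp finite moment inequality $$256A^3D^3-128A^2B^2D^2+144A^2BC^2D-27A^2C^4+16AB^4D-4AB^3C^2\ge 0.$$
   Context: Let $P(t)=\prod_{i=1}^n(t-x_i)$ be a monic polynomial of degree $n$ with roots $x_1,\dots,x_n$, and for $0\le k\le n-2$ let $\mathcal D_k^{(n)}=\operatorname{disc}(P^{(k)})$ be the discriminant of the $k$-th derivative, with the usual leading-coefficient normalization: $\operatorname{disc}(P^{(k)})=(-1)^{m(m-1)/2}c^{-1}\operatorname{Res}(P^{(k)},P^{(k+1)})$, where $m=n-k$ and $c$ is the leading coefficient of $P^{(k)}$. Put $\bar x=\frac1n\sum_{i=1}^n x_i$ and $p_r=\sum_{i=1}^n (x_i-\bar x)^r$. *)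

(* Defs.v *)
From HB Require Import structures.
From mathcomp Require Import all_boot all_order all_algebra.

Set Implicit Arguments.
Unset Strict Implicit.
Unset Printing Implicit Defensive.

Import Order.TTheory GRing.Theory Num.Theory.
Local Open Scope ring_scope.

(* disc p = (-1)^(m(m-1)/2) c^-1 Res(p, p'), with m = deg p, c = lead_coef p.
   [Sylvester_mx] lists coefficients by increasing degree; compared with the
   decreasing convention this multiplies Res(p, q) by (-1)^(deg p * deg q),
   which is 1 for q = p' in characteristic 0. *)
Definition disc (F : fieldType) (p : {poly F}) : F :=
  let m := (size p).-1 in
  (-1) ^+ ((m * m.-1) %/ 2) * (lead_coef p)^-1 * resultant p p^`().

Section RootData.

Variables (F : fieldType) (n : nat) (x : 'I_n -> F).

Definition root_poly : {poly F} := \prod_(i < n) ('X - (x i)%:P).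

Definition deriv_disc (k : nat) : F := disc root_poly^`(k).

Definition root_mean : F := (\sum_(i < n) x i) / n%:R.

Definition central_sum (r : nat) : F := \sum_(i < n) (x i - root_mean) ^+ r.

(* The truncated subtractions below are meant for 4 <= n. *)
Definition coefA : F := n`!%:R / 24%:R.

Definition coefB : F := - ((n - 2)`!%:R / 4%:R * central_sum 2).

Definition coefC : F := - ((n - 3)`!%:R / 3%:R * central_sum 3).

Definition coefD : F :=
  (n - 4)`!%:R * (central_sum 2 ^+ 2 / 8%:R - central_sum 4 / 4%:R).

Definition moment_quartic : {poly F} :=
  coefA *: 'X^4 + coefB *: 'X^2 + coefC *: 'X + coefD%:P.

Definition moment_form : F :=
  let A := coefA in let B := coefB in let C := coefC in let D := coefD in
  256%:R * A ^+ 3 * D ^+ 3 - 128%:R * A ^+ 2 * B ^+ 2 * D ^+ 2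
  + 144%:R * A ^+ 2 * B * C ^+ 2 * D - 27%:R * A ^+ 2 * C ^+ 4
  + 16%:R * A * B ^+ 4 * D - 4%:R * A * B ^+ 3 * C ^+ 2.

End RootData.

(* Main.v *)
Require Import Defs.
From HB Require Import structures.
From mathcomp Require Import all_boot all_order all_algebra.
From mathcomp Require Import complex ring zify.

Set Implicit Arguments.
Unset Strict Implicit.
Unset Printing Implicit Defensive.

Import Order.TTheory GRing.Theory Num.Theory.
Local Open Scope ring_scope.

(* Translating the roots by their mean m turns P into a centred polynomial Q,
   whose top five coefficients are given by Newton's identities with
   p_1 = 0; hence P^(n-4) is the moment quartic evaluated at t - m, and the
   discriminant is invariant under translation. Over a real closed field all
   complex roots of Q are real, so by Gauss-Lucas so are those of the moment
   quartic, and its discriminant a^6 prod_(i<j) (r_i - r_j)^2 is a square.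
   For P = t^(n-1) (t - 1), P^(n-4) is divisible by t^3 and equality holds. *)

(** * The discriminant of a quartic as a determinant *)

(* Expansion along the first column of the matrix with rows s, where None is a
   zero entry: marking zeros syntactically lets evaluation prune the minors
   over an abstract ring. *)
Fixpoint laplace (R : comNzRingType) n (s : seq (seq (option R))) : R :=
  if n is m.+1 then
    foldr (fun i acc =>
      if nth None (nth [::] s i) 0 is Some a then
        (-1) ^+ i * a * laplace m (map behead (take i s ++ drop i.+1 s)) + acc
      else acc) 0 (iota 0 n)
  else 1.

Lemma det_laplace (R : comNzRingType) n (s : seq (seq (option R))) :
  size s = n ->
  \det (\matrix_(i < n, j < n) odflt 0 (nth None (nth [::] s i) j))
    = laplace n s.
Proof.
elim: n s => [|n IHn] s ss; first by rewrite det_mx00.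
pose x i := nth None (nth [::] s i) 0.
pose minor i := map behead (take i s ++ drop i.+1 s).
(* Deleting row [i] is the [take]/[drop] splice and deleting column 0 is [behead], so the induction
   hypothesis applies to each minor. *)
have cofE (i : 'I_n.+1) : cofactor
    (\matrix_(i < n.+1, j < n.+1) odflt 0 (nth None (nth [::] s i) j)) i ord0
    = (-1) ^+ i * laplace n (minor i).
  have size_minor : size (minor i) = n.
    rewrite size_map size_cat size_take size_drop ss ltn_ord subSS.
    by rewrite subnKC // -ltnS.
  rewrite /cofactor addn0 -IHn //; congr (_ * \det _).
  apply/matrixP=> j k; rewrite !mxE /= (nth_map [::]); last first.
    by rewrite size_map in size_minor; rewrite size_minor.
  rewrite nth_behead nth_cat size_take ss ltn_ord /bump.
  case: ltnP => ij; first by rewrite nth_take.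
  by rewrite nth_drop addSn subnKC.
transitivity (foldr (fun i acc => if x i is Some a
  then (-1) ^+ i * a * laplace n (minor i) + acc else acc) 0 (iota 0 n.+1)) => //.
rewrite (expand_det_col _ ord0).
under eq_bigr => i _ do rewrite cofE mxE -/(x i).
rewrite -(big_mkord xpredT (fun i =>
  odflt 0 (x i) * ((-1) ^+ i * laplace n (minor i)))) unlock /index_iota subn0.
elim: (iota 0 n.+1) => //= i l ->.
by case: (x i) => [a|] /=; rewrite ?mul0r ?add0r // mulrCA mulrA.
Qed.

(** The classical sixteen-term discriminant of a t^4 + b t^3 + c t^2 + d t + e. *)
Definition quartic_disc (R : comNzRingType) (a b c d e : R) : R :=
  256%:R * a ^+ 3 * e ^+ 3 - 192%:R * a ^+ 2 * b * d * e ^+ 2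
  - 128%:R * a ^+ 2 * c ^+ 2 * e ^+ 2 + 144%:R * a ^+ 2 * c * d ^+ 2 * e
  - 27%:R * a ^+ 2 * d ^+ 4 + 144%:R * a * b ^+ 2 * c * e ^+ 2
  - 6%:R * a * b ^+ 2 * d ^+ 2 * e - 80%:R * a * b * c ^+ 2 * d * e
  + 18%:R * a * b * c * d ^+ 3 + 16%:R * a * c ^+ 4 * e
  - 4%:R * a * c ^+ 3 * d ^+ 2 - 27%:R * b ^+ 4 * e ^+ 2
  + 18%:R * b ^+ 3 * c * d * e - 4%:R * b ^+ 3 * d ^+ 3
  - 4%:R * b ^+ 2 * c ^+ 3 * e + b ^+ 2 * c ^+ 2 * d ^+ 2.

(** The arguments on the left are the coefficients of the quartic at t + h, so translation
    invariance is a ring identity and needs no splitting field. *)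
Lemma quartic_disc_shift (R : comNzRingType) (a b c d e h : R) :
  quartic_disc a (b + 4%:R * a * h) (c + 3%:R * b * h + 6%:R * a * h ^+ 2)
    (d + 2%:R * c * h + 3%:R * b * h ^+ 2 + 4%:R * a * h ^+ 3)
    (e + d * h + c * h ^+ 2 + b * h ^+ 3 + a * h ^+ 4)
  = quartic_disc a b c d e.
Proof. by rewrite /quartic_disc; ring. Qed.

(** Vieta's formulas for the roots [r], [s], [t], [u]. The square on the right is the source of
    nonnegativity. *)
Lemma quartic_disc_roots (R : comNzRingType) (a r s t u : R) :
  quartic_disc a (- a * (r + s + t + u))
    (a * (r * s + r * t + r * u + s * t + s * u + t * u))
    (- a * (r * s * t + r * s * u + r * t * u + s * t * u))
    (a * (r * s * t * u))
  = (a ^+ 3 * ((r - s) * (r - t) * (r - u) * (s - t) * (s - u) * (t - u))) ^+ 2.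
Proof. by rewrite /quartic_disc; ring. Qed.

(** The rows form the Sylvester matrix of the quartic and its derivative, by increasing degree. The
    extra factor [a] cancels the inverse leading coefficient in [disc]. *)
Lemma laplace_quartic (R : comNzRingType) (a b c d e : R) :
  let o := None in
  let b1 := c *+ 2 in let b2 := b *+ 3 in let b3 := a *+ 4 in
  laplace 7 [:: [:: Some e; Some d; Some c; Some b; Some a; o; o];
                [:: o; Some e; Some d; Some c; Some b; Some a; o];
                [:: o; o; Some e; Some d; Some c; Some b; Some a];
                [:: Some d; Some b1; Some b2; Some b3; o; o; o];
                [:: o; Some d; Some b1; Some b2; Some b3; o; o];
                [:: o; o; Some d; Some b1; Some b2; Some b3; o];
                [:: o; o; o; Some d; Some b1; Some b2; Some b3]]
  = a * quartic_disc a b c d e.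
Proof.
move=> o b1 b2 b3.
cbv beta iota zeta
  delta [laplace foldr iota nth map behead take drop cat o b1 b2 b3].
by rewrite /quartic_disc; ring.
Qed.

(** Replaces the dimension of a Sylvester matrix, computed from [size], by a literal without a
    cast. *)
Lemma det_nat_entries (R : comNzRingType) N M (A : 'M[R]_N)
    (f : nat -> nat -> R) :
  N = M -> (forall i j, A i j = f i j) ->
  \det A = \det (\matrix_(i < M, j < M) f i j).
Proof. by move=> <- Af; congr (\det _); apply/matrixP=> i j; rewrite mxE Af. Qed.

Lemma disc_quartic (F : fieldType) (p : {poly F}) :
  size p = 5%N -> 4%:R != 0 :> F ->
  disc p = quartic_disc p`_4 p`_3 p`_2 p`_1 p`_0.
Proof.
move=> sp nz4.
have nz_a : p`_4 != 0.
  have : lead_coef p != 0 by rewrite lead_coef_eq0 -size_poly_gt0 sp.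
  by rewrite lead_coefE sp.
(* As 4 is nonzero, the cubic coefficient 4a of the derivative survives. *)
have sq : size p^`() = 4%N.
  have : (size p^`() < size p)%N by rewrite lt_size_deriv // -size_poly_gt0 sp.
  rewrite sp ltnS => sq; apply/eqP; rewrite eqn_leq sq /=.
  rewrite ltnNge; apply/negP => /leq_sizeP/(_ 3 isT)/eqP.
  rewrite coef_deriv -[X in X == 0]mulr_natr.
  by rewrite mulf_eq0 (negPf nz_a) (negPf nz4).
(* The sign exponent is 4 * 3 / 2 = 6, which is even. *)
rewrite /disc lead_coefE sp /= -signr_odd expr0 mul1r.
suff -> : resultant p p^`() = p`_4 * quartic_disc p`_4 p`_3 p`_2 p`_1 p`_0.
  by rewrite mulKf.
rewrite -laplace_quartic -det_laplace // /resultant.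
pose dq := (size p^`()).-1.
pose f i j := if (i < dq)%N then p`_(j - i) *+ (i <= j)
  else p^`()`_(j - (i - dq)) *+ (i - dq <= j).
have sylvE i j : Sylvester_mx p p^`() i j = f i j.
  by rewrite Sylvester_mxE /f; case: splitP => k ->; rewrite ?addKn.
rewrite (det_nat_entries _ sylvE (M := 7)) ?sq ?sp //.
(* Entries beyond the degrees default to 0; they match the [None] entries. *)
have p_out : (p`_5 = 0) * (p`_6 = 0) by rewrite !nth_default ?sp.
have q_out : (p^`()`_4 = 0) * (p^`()`_5 = 0) * (p^`()`_6 = 0).
  by rewrite !nth_default ?sq.
congr (\det _); apply/matrixP => -[i lti] [j ltj]; rewrite !mxE /f /dq sq /=.
do 7?[case: i lti => [|i] lti //]; do 7?[case: j ltj => [|j] ltj //];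
by rewrite /= ?mulr1n ?p_out ?q_out ?coef_deriv.
Qed.

(** * Real-rootedness under differentiation *)

Definition real_rooted (C : numClosedFieldType) (p : {poly C}) :=
  forall z, root p z -> z \is Num.real.

(** The logarithmic derivative, multiplied through by the product. *)
Lemma horner_deriv_prod_XsubC (F : fieldType) (s : seq F) w :
  w \notin s ->
  (\prod_(z <- s) ('X - z%:P))^`().[w]
    = (\prod_(z <- s) ('X - z%:P)).[w] * \sum_(z <- s) (w - z)^-1.
Proof.
elim: s => [|z s IHs]; first by rewrite !big_nil derivC horner0 mulr0.
rewrite inE negb_or !big_cons derivM derivXsubC mul1r => /andP[nwz /IHs ws].
rewrite hornerD !hornerM hornerXsubC ws; field.
by rewrite subr_eq0.
Qed.

(* Gauss-Lucas for the real line: if Im w <> 0 and all z are real, the terms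
   of p'(w) / p(w) = sum_z 1 / (w - z) have imaginary parts of the same sign. *)
Lemma real_rooted_deriv (C : numClosedFieldType) (p : {poly C}) :
  (1 < size p)%N -> real_rooted p -> real_rooted p^`().
Proof.
have [s p_s] := closed_field_poly_normal p; rewrite {}p_s => sp p_real w.
have c_neq0 : lead_coef p != 0.
  by apply: contraTneq sp => ->; rewrite scale0r size_poly0.
have s_real z : z \in s -> z \is Num.real.
  by move=> zs; apply: p_real; rewrite rootZ // root_prod_XsubC.
have [ws _|ws] := boolP (w \in s); first exact: s_real.
rewrite derivZ rootZ // rootE horner_deriv_prod_XsubC // mulf_eq0.
rewrite -rootE root_prod_XsubC (negPf ws) /= => /eqP sum0.
have term z : z \in s -> 'Im (w - z)^-1 = - 'Im w * `|w - z| ^- 2.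
  move=> zs; rewrite invC_norm ImMl; last by rewrite rpredV rpredX // normr_real.
  rewrite Im_conj raddfB /= (Creal_ImP _ (s_real _ zs)) subr0.
  by rewrite mulrC.
have /(congr1 (@Im C)) := sum0.
rewrite raddf_sum raddf0 (eq_big_seq _ term) -mulr_sumr /=.
move/eqP; rewrite mulf_eq0 oppr_eq0 => /orP[/eqP/Creal_ImP //|].
rewrite psumr_eq0 => [|z _]; last by rewrite invr_ge0 exprn_ge0.
(* The degree hypothesis excludes an empty [s]; the first summand is then nonzero because [w]
   differs from [z]. *)
case: s sp {p_real s_real sum0 term} ws => [|z s _].
  by rewrite big_nil size_scale // size_poly1.
rewrite inE negb_or => /andP[nwz _] /= /andP[].
by rewrite invr_eq0 expf_eq0 normr_eq0 subr_eq0 (negPf nwz).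
Qed.

Lemma real_rooted_derivn (C : numClosedFieldType) (p : {poly C}) k :
  (k < size p)%N -> real_rooted p -> real_rooted p^`(k).
Proof.
move=> + p_real; elim: k => [//|k IHk] kp.
rewrite derivnS; apply: real_rooted_deriv; last exact/IHk/ltnW.
(* At this index the k-th derivative has the leading coefficient of [p] times a positive falling
   factorial, which cannot vanish. *)
rewrite ltnNge; apply/negP => /leq_sizeP/(_ ((size p).-1 - k)%N).
have kp' : (k < (size p).-1)%N by rewrite -ltnS (ltn_predK kp).
rewrite subn_gt0 => /(_ kp')/eqP; rewrite coef_derivn subnKC 1?ltnW //.
rewrite -lead_coefE mulrn_eq0 lead_coef_eq0 -size_poly_eq0.
by rewrite (gtn_eqF (leq_ltn_trans _ kp)) // orbF -leqn0 leqNgt ffact_gt0 (ltnW kp').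
Qed.

(** * Newton's identities for the top coefficients *)

(* The factor 'X^4 keeps the top five coefficients at natural indices when
   size s < 4. *)
Lemma prod_XsubC_top_coefs (R : comNzRingType) (s : seq R) :
  let n := size s in
  let q := 'X^4 * \prod_(y <- s) ('X - y%:P) in
  let P r := \sum_(y <- s) y ^+ r in
  [/\ q`_n.+4 = 1, q`_n.+3 = - P 1, 2%:R * q`_n.+2 = P 1 ^+ 2 - P 2,
      6%:R * q`_n.+1 = - (P 1 ^+ 3 - 3%:R * P 1 * P 2 + 2%:R * P 3)
    & 24%:R * q`_n = P 1 ^+ 4 - 6%:R * P 1 ^+ 2 * P 2 + 3%:R * P 2 ^+ 2
                     + 8%:R * P 1 * P 3 - 6%:R * P 4].
Proof.
elim: s => [|y s /=]; set n := size _.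
  by rewrite /= !big_nil mulr1 !coefXn /=; split; ring.
set q := 'X^4 * _; case=> c4 c3 c2 c1 c0; rewrite !big_cons.
have -> : 'X^4 * (('X - y%:P) * \prod_(z <- s) ('X - z%:P)) = ('X - y%:P) * q.
  by rewrite mulrCA.
have cE i : (('X - y%:P) * q)`_i.+1 = q`_i - y * q`_i.+1.
  by rewrite mulrBl coefB coefXM coefCM.
have q5 : q`_n.+4.+1 = 0.
  rewrite nth_default // (leq_trans (size_polyMleq _ _)) // size_polyXn.
  by rewrite size_prod_XsubC.
rewrite !cE q5 c4 c3; split.
- by ring.
- by ring.
- by rewrite mulrBr c2; ring.
(* The factorials 2, 6, 24 avoid division; splitting 6 = 3 * 2 here and 24 = 4 * 6 below exposes the
   induction hypotheses. *)
- have -> : 6%:R * (q`_n.+1 - y * q`_n.+2)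
    = 6%:R * q`_n.+1 - 3%:R * y * (2%:R * q`_n.+2) by ring.
  by rewrite c1 c2; ring.
- have -> : 24%:R * (q`_n - y * q`_n.+1)
    = 24%:R * q`_n - 4%:R * y * (6%:R * q`_n.+1) by ring.
  by rewrite c0 c1; ring.
Qed.

(** * Translation of quartics *)

Lemma quartic_polyE (R : nzRingType) (p : {poly R}) :
  (size p <= 5)%N -> p = Poly [:: p`_0; p`_1; p`_2; p`_3; p`_4].
Proof.
move=> sp; apply/polyP=> i; rewrite coef_Poly.
case: i => [|[|[|[|[|i]]]]] //=.
by rewrite nth_nil nth_default // (leq_trans sp).
Qed.

Lemma quartic_comp_XaddC (R : comNzRingType) (a b c d e h : R) :
  Poly [:: e; d; c; b; a] \Po ('X + h%:P) =
  Poly [:: e + d * h + c * h ^+ 2 + b * h ^+ 3 + a * h ^+ 4;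
           d + 2%:R * c * h + 3%:R * b * h ^+ 2 + 4%:R * a * h ^+ 3;
           c + 3%:R * b * h + 6%:R * a * h ^+ 2; b + 4%:R * a * h; a].
Proof.
rewrite /= !cons_poly_def !comp_poly_MXaddC comp_poly0.
rewrite !(rmorphD, rmorphM, rmorphXn, rmorph_nat) /=.
by ring.
Qed.

Lemma disc_quartic_comp_XaddC (F : fieldType) (p : {poly F}) (h : F) :
  size p = 5%N -> 4%:R != 0 :> F -> disc (p \Po ('X + h%:P)) = disc p.
Proof.
move=> sp nz4; rewrite !disc_quartic ?size_comp_poly2 ?size_XaddC //.
rewrite [in LHS](quartic_polyE (eq_leq sp)) quartic_comp_XaddC !coef_Poly /=.
exact: quartic_disc_shift.
Qed.

Lemma size_index_ord n : size (index_enum 'I_n) = n.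
Proof. by rewrite [index_enum _]unlock -enumT size_enum_ord. Qed.

(** * The centred polynomial and its derivative of order n - 4 *)

Section CharZero.

Variables (F : fieldType) (n : nat) (x : 'I_n -> F).
Hypothesis F_char0 : [pchar F] =i pred0.

Let natr_neq0 k : (0 < k)%N -> k%:R != 0 :> F.
Proof. by move/pcharf0P: F_char0 => ->; rewrite lt0n. Qed.

Let y i := x i - root_mean x.

Lemma root_poly_center : root_poly x = root_poly y \Po ('X - (root_mean x)%:P).
Proof.
rewrite /root_poly rmorph_prod; apply: eq_bigr => i _ /=.
by rewrite rmorphB /= comp_polyX comp_polyC /y rmorphB /=; ring.
Qed.

Lemma derivn_comp_XsubC (p : {poly F}) h k :
  (p \Po ('X - h%:P))^`(k) = p^`(k) \Po ('X - h%:P).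
Proof.
elim: k => [//|k IHk].
by rewrite !derivnS IHk deriv_comp derivXsubC mulr1.
Qed.

Hypothesis n_ge4 : (4 <= n)%N.

Lemma central_sum1 : central_sum x 1 = 0.
Proof.
rewrite /central_sum; under eq_bigr do rewrite expr1.
rewrite sumrB sumr_const card_ord /root_mean -[X in _ - X]mulr_natr.
by rewrite divfK ?subrr // natr_neq0 // (leq_trans _ n_ge4).
Qed.

(** With p_1 = 0 only -p_2, -2 p_3 and 3 p_2^2 - 6 p_4 survive in Newton's identities, to be divided
    by 2, 6 and 24. *)
Lemma root_poly_center_coefs :
  [/\ (root_poly y)`_n = 1, (root_poly y)`_(n - 1) = 0,
      (root_poly y)`_(n - 2) = - (central_sum x 2 / 2%:R),
      (root_poly y)`_(n - 3) = - (central_sum x 3 / 3%:R)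
    & (root_poly y)`_(n - 4)
        = central_sum x 2 ^+ 2 / 8%:R - central_sum x 4 / 4%:R].
Proof.
have := prod_XsubC_top_coefs [seq y i | i <- index_enum 'I_n].
rewrite /= !big_map size_map size_index_ord -/(root_poly y).
rewrite -/(central_sum x 1) -/(central_sum x 2) -/(central_sum x 3).
rewrite -/(central_sum x 4) central_sum1.
(* Undoes the shift by ['X^4]; since 4 <= n, no coefficient is cut off. *)
rewrite !coefXnM !(ltnNge _ 4) /=.
have -> : (n.+4 - 4 = n)%N by lia.
have -> : (n.+3 - 4 = n - 1)%N by lia.
have -> : (n.+2 - 4 = n - 2)%N by lia.
have -> : (n.+1 - 4 = n - 3)%N by lia.
have -> : (4 <= n.+3)%N by lia.
have -> : (4 <= n.+2)%N by lia.
have -> : (4 <= n.+1)%N by lia.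
have -> : (4 <= n)%N by lia.
move=> /= [-> -> c2 c3 c4]; split=> //=; first by rewrite oppr0.
- apply: (mulfI (natr_neq0 (isT : 0 < 2)%N)).
  by rewrite c2; field; rewrite natr_neq0.
- apply: (mulfI (natr_neq0 (isT : 0 < 6)%N)).
  by rewrite c3; field; rewrite !natr_neq0.
- apply: (mulfI (natr_neq0 (isT : 0 < 24)%N)).
  by rewrite c4; field; rewrite !natr_neq0.
Qed.

Lemma derivn_root_poly_center : (root_poly y)^`(n - 4) = moment_quartic x.
Proof.
have [cn cn1 cn2 cn3 cn4] := root_poly_center_coefs.
(* The factor that differentiation puts on the coefficient of degree n - 4 + i, written with the
   factorials of [coefA] to [coefD]. *)
have ffactE i : (i <= 4)%N ->
    ((n - 4 + i) ^_ (n - 4))%:R = (n - (4 - i))`!%:R / i`!%:R :> F.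
  move=> le_i4; apply: (mulIf (natr_neq0 (fact_gt0 i))).
  rewrite divfK ?natr_neq0 ?fact_gt0 // -natrM; congr _%:R.
  have -> : (n - (4 - i) = n - 4 + i)%N by lia.
  by have := ffact_fact (leq_addr i (n - 4)); rewrite addKn.
apply/polyP=> i; rewrite coef_derivn /moment_quartic.
rewrite !coefD !coefZ !coefXn coefX coefC.
have [i_gt4|i_le4] := ltnP 4 i.
  rewrite nth_default ?mul0rn; last first.
    by rewrite size_prod_XsubC size_index_ord; lia.
  by case: i i_gt4 => [|[|[|[|[|i]]]]] //= _; rewrite !mulr0 !addr0.
rewrite -[_ *+ (_ ^_ _)]mulr_natr ffactE //.
case: i i_le4 => [|[|[|[|[|i]]]]] // _ /=.
- by rewrite addn0 cn4 !mulr0 !add0r /Defs.coefD subn0 -[0`!]/1%N divr1 mulrC.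
- have -> : (n - 4 + 1 = n - 3)%N by lia.
  rewrite cn3 /Defs.coefC -[1`!]/1%N divr1 -[(4 - 1)%N]/3%N.
  by field; rewrite natr_neq0.
- have -> : (n - 4 + 2 = n - 2)%N by lia.
  rewrite cn2 /Defs.coefB -[2`!]/2%N -[(4 - 2)%N]/2%N.
  by field; rewrite !natr_neq0.
- have -> : (n - 4 + 3 = n - 1)%N by lia.
  by rewrite cn1; ring.
- have -> : (n - 4 + 4 = n)%N by lia.
  by rewrite cn /coefA -[4`!]/24%N subn0; field; rewrite !natr_neq0.
Qed.

End CharZero.

(** * Nonnegativity and the equality case *)

Lemma moment_formE (F : fieldType) n (x : 'I_n -> F) :
  moment_form x =
  quartic_disc (coefA F n) 0 (Defs.coefB x) (Defs.coefC x) (Defs.coefD x).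
Proof. by rewrite /moment_form /quartic_disc; ring. Qed.

Lemma moment_quarticE (F : fieldType) n (x : 'I_n -> F) :
  moment_quartic x =
  Poly [:: Defs.coefD x; Defs.coefC x; Defs.coefB x; 0; Defs.coefA F n].
Proof. by rewrite /moment_quartic /= !cons_poly_def -!mul_polyC; ring. Qed.

Lemma size_moment_quartic (F : fieldType) n (x : 'I_n -> F) :
  [pchar F] =i pred0 -> size (moment_quartic x) = 5%N.
Proof.
move=> /pcharf0P F0; rewrite moment_quarticE (@PolyK _ 0) //=.
by rewrite mulf_neq0 ?invr_neq0 ?F0 // -lt0n fact_gt0.
Qed.

Lemma real_rooted_quartic_disc_ge0 (R : rcfType) (p : {poly R}) :
  size p = 5%N -> real_rooted (map_poly (real_complex R) p) ->
  0 <= quartic_disc p`_4 p`_3 p`_2 p`_1 p`_0.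
Proof.
move=> sp p_real; pose a := lead_coef p.
have [s p_s] := closed_field_poly_normal (map_poly (real_complex R) p).
rewrite lead_coef_map in p_s.
have a_neq0 : (a%:C)%C != 0.
  by rewrite (fmorph_eq0 (real_complex R)) lead_coef_eq0 -size_poly_gt0 sp.
(* The complex roots are the images of their real parts, so the factorization descends to [R] by
   injectivity of the embedding. *)
have s_real : s = map (real_complex R) (map (@complex.Re R) s).
  rewrite -map_comp -[LHS]map_id; apply/eq_in_map => z zs /=.
  by rewrite RRe_real //; apply: p_real; rewrite p_s rootZ // root_prod_XsubC.
have size_s : size s = 4%N.
  have : size (map_poly (real_complex R) p) = 5%N by rewrite size_map_poly.
  by rewrite p_s size_scale // size_prod_XsubC => -[].
have {p_s} -> : p = a *: \prod_(r <- map (@complex.Re R) s) ('X - r%:P).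
  apply: (map_poly_inj (real_complex R)); rewrite p_s map_polyZ /=.
  congr (_ *: _); rewrite rmorph_prod {1}s_real !big_map.
  by apply: eq_bigr => r _; rewrite rmorphB /= map_polyX map_polyC.
have : size (map (@complex.Re R) s) = 4%N by rewrite size_map.
case: (map _ s) => [|r1 [|r2 [|r3 [|r4 [|//]]]]] // _.
rewrite !big_cons big_nil.
have -> : a *: (('X - r1%:P) * (('X - r2%:P) * (('X - r3%:P)
    * (('X - r4%:P) * 1)))) =
  Poly [:: a * (r1 * r2 * r3 * r4);
   - a * (r1 * r2 * r3 + r1 * r2 * r4 + r1 * r3 * r4 + r2 * r3 * r4);
   a * (r1 * r2 + r1 * r3 + r1 * r4 + r2 * r3 + r2 * r4 + r3 * r4);
   - a * (r1 + r2 + r3 + r4); a].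
  rewrite /= !cons_poly_def -mul_polyC.
  by rewrite !(rmorphD, rmorphM, rmorphN) /=; ring.
by rewrite !coef_Poly /= quartic_disc_roots sqr_ge0.
Qed.

Lemma map_root_poly_real_rooted (R : rcfType) n (x : 'I_n -> R) :
  real_rooted (map_poly (real_complex R) (root_poly x)).
Proof.
move=> z; rewrite /root_poly rmorph_prod /=.
under eq_bigr => i _ do rewrite rmorphB /= map_polyX map_polyC /=.
rewrite -(big_map (fun i => (x i)%:C%C) xpredT (fun z => 'X - z%:P)).
by rewrite root_prod_XsubC => /mapP[i _ ->]; rewrite complex_real.
Qed.

Lemma moment_form_ge0 (R : rcfType) n (x : 'I_n -> R) :
  (4 <= n)%N -> 0 <= moment_form x.
Proof.
move=> n_ge4; have R_char0 := pchar_num R.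
have -> : moment_form x = let q := moment_quartic x in
    quartic_disc q`_4 q`_3 q`_2 q`_1 q`_0.
  by rewrite /= moment_quarticE !coef_Poly moment_formE.
apply: real_rooted_quartic_disc_ge0; first exact: size_moment_quartic.
rewrite -derivn_root_poly_center // -derivn_map.
apply: real_rooted_derivn; last exact: map_root_poly_real_rooted.
by rewrite size_map_poly size_prod_XsubC size_index_ord; lia.
Qed.

Lemma moment_form_single_nonzero (F : fieldType) k :
  [pchar F] =i pred0 ->
  moment_form (fun i : 'I_k.+4 => (i == ord0)%:R : F) = 0.
Proof.
move=> /pcharf0P F0; set x := fun _ => _.
have nE : k.+4%:R = k%:R + 4%:R :> F by rewrite -natrD addn4.
have nz : k%:R + 4%:R != 0 :> F by rewrite -nE F0.
have meanE : root_mean x = (k%:R + 4%:R)^-1.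
  by rewrite /root_mean nE big_ord_recl big1 ?addr0 /x ?eqxx ?mul1r.
(* One centred root is 1 - 1/n and the other n - 1 = k + 3 are -1/n. *)
have centralE r : central_sum x r =
    (1 - (k%:R + 4%:R)^-1) ^+ r + (k%:R + 3%:R) * (- (k%:R + 4%:R)^-1) ^+ r.
  rewrite /central_sum meanE big_ord_recl /=; congr (_ + _).
  under eq_bigr do rewrite /x /= sub0r.
  by rewrite sumr_const card_ord -[LHS]mulr_natl -addn3 natrD.
rewrite moment_formE /coefA /Defs.coefB /Defs.coefC /Defs.coefD !centralE.
have -> : (k.+4 - 2 = k.+2)%N by lia.
have -> : (k.+4 - 3 = k.+1)%N by lia.
have -> : (k.+4 - 4 = k)%N by lia.
have k3 : k.+3%:R = k%:R + 3%:R :> F by rewrite -natrD addn3.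
have k2 : k.+2%:R = k%:R + 2%:R :> F by rewrite -natrD addn2.
have k1 : k.+1%:R = k%:R + 1 :> F by rewrite -natr1.
(* All factorials reduce to multiples of that of [k], leaving a rational identity in [k] and its
   factorial. *)
rewrite !factS !natrM nE k3 k2 k1 /quartic_disc.
by field; rewrite !F0 nz.
Qed.

Theorem theorem6 (n : nat) (n_ge4 : (4 <= n)%N) :
  (forall (F : fieldType) (F_char0 : [pchar F] =i pred0) (x : 'I_n -> F),
     deriv_disc x (n - 4) = disc (moment_quartic x)
     /\ deriv_disc x (n - 4) = moment_form x)
  /\ (forall R : rcfType,
        (forall x : 'I_n -> R, 0 <= moment_form x)
        /\ (exists x : 'I_n -> R,
              (exists i j : 'I_n, x i != x j) /\ moment_form x = 0)).
Proof.
split=> [F F_char0 x|R].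
  have nz4 : 4%:R != 0 :> F by move/pcharf0P: F_char0 => ->.
  have sM : size (moment_quartic x) = 5%N by exact: size_moment_quartic.
  have discE : deriv_disc x (n - 4) = disc (moment_quartic x).
    rewrite /deriv_disc root_poly_center derivn_comp_XsubC.
    rewrite derivn_root_poly_center //.
    by rewrite -polyCN disc_quartic_comp_XaddC.
  split=> //; rewrite discE disc_quartic //.
  by rewrite moment_quarticE !coef_Poly moment_formE.
split=> [x|]; first exact: moment_form_ge0.
case: n n_ge4 => [|[|[|[|k]]]] // _.
(* Roots that are not all equal, so equality is not attained only in the trivial case. *)
exists (fun i => (i == ord0)%:R); split; last first.
  exact: moment_form_single_nonzero (pchar_num R).
by exists ord0, ord_max; rewrite eqxx oner_neq0.
Qed.
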